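(* Let $\Sigma\subset\mathbb{E}$ be a $2$-dimensional $C^1$ smooth submanifold of degree $3$ in the Engel group and let $p\in\Sigma$ be a point of maximum degree $3$. Let $(Y_1,Y_2,Y_3,Y_4)$ be the orthonormal graded basis of a special parametrization of $p^{-1}\Sigma$ at $0$ (defined in the context), and let $\xi_{12},\xi_{13},\xi_{23}\in\mathbb{R}$ be its structure coefficients, defined by $$[Y_1,Y_2]=\xi_{12}Y_3,\qquad[Y_1,Y_3]=\xi_{13}Y_4,\qquad[Y_2,Y_3]=\xi_{23}Y_4.$$ Then $\xi_{13}=0$.
   Context: Engel group. $\mathbb{E}$ is the connected, simply connected Lie group whose Lie algebra $\mathrm{Lie}(\mathbb{E})=V_1\oplus V_2\oplus V_3$ has a basis $(X_1,\dots,X_4)$ with only nontrivial brackets $[X_1,X_2]=X_3$, $[X_1,X_3]=X_4$; $V_1=\mathrm{span}\{X_1,X_2\}$, $V_2=\mathrm{span}\{X_3\}$, $V_3=\mathrm{span}\{X_4\}$. Via $\exp$, $\mathbb{E}$ is identified with a graded vector space with Baker-Campbell-Hausdorff product and unit $0$. A graded basis $(Y_1,\dots,Y_4)$ of $\mathrm{Lie}(\mathbb{E})$ is a basis with $Y_1,Y_2\in V_1$, $Y_3\in V_2$, $Y_4\in V_3$; the degrees are $d_1=d_2=1$, $d_3=2$, $d_4=3$. A left invariant Riemannian metric $g$ that makes some graded basis orthonormal is fixed; ''orthonormal'' refers to it. Degree. For a $2$-dimensional $C^1$ submanifold $\Sigma$ and $p\in\Sigma$, take a basis $(t_1,t_2)$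 of $T_p\Sigma$ and write $t_1\wedge t_2=\sum_{i<j}c_{ij}Y_i(p)\wedge Y_j(p)$ for a graded basis. Then $d_\Sigma(p)=\max\{d_i+d_j:c_{ij}\ne0\}$ (independent of the graded basis), $d(\Sigma)=\max_\Sigma d_\Sigma$, and $p$ has maximum degree if $d_\Sigma(p)=d(\Sigma)$. Special parametrization at $0$. Let $n_1=2$, $n_2=n_3=1$, $m_0=0,m_1=2,m_2=3,m_3=4$. Let $S\subset\mathbb{E}$ be a $2$-dimensional $C^1$ submanifold with $0\in S$. A special parametrization of $S$ at $0$ consists of integers $0\le\alpha_j\le n_j$ ($j=1,2,3$) with $\alpha_1+\alpha_2+\alpha_3=2$, an orthonormal graded basis $(Y_1,\dots,Y_4)$, a bounded open neighborhood $U\subset\mathbb{R}^2$ of $0$ and a $C^1$ embedding $\Phi:U\to S$ with $\Phi(0)=0$ such that, with $F:\mathbb{R}^4\to\mathbb{E}$, $F(y)=\exp(\sum_jy_jY_j)$, $\phi=F^{-1}\circ\Phi$, $\mu_0=0$, $\mu_j=\alpha_1+\cdots+\alpha_j$: (i) $\phi_s(u)=u_{s-m_{j-1}+\mu_{j-1}}$ for $s=m_{j-1}+1,\dots,m_{j-1}+\alpha_j$, $j=1,2,3$; (ii) dividing the rows of $D\phi(0)$ into groups of sizes $n_1,n_2,n_3$ and the columns into groups of sizes $\alpha_1,\alpha_2,\alpha_3$, the $(j,i)$ block is $0$ if $i<j$, is $\binom{I_{\alpha_j}}{0}$ if $i=j$, and is $\binom{0}{*}$, with $*$ an arbitrary $(n_j-\alpha_j)\times\alpha_i$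 matrix, if $i>j$. Such a special parametrization always exists. *)

(* Defs.v *)
From mathcomp Require Export all_boot all_order all_algebra.
From mathcomp Require Export all_classical all_reals all_analysis.
Export Order.TTheory GRing.Theory Num.Theory numFieldNormedType.Exports.

Set Implicit Arguments.
Unset Strict Implicit.
Unset Printing Implicit Defensive.

#[global] Open Scope classical_set_scope.
#[global] Open Scope ring_scope.

(* Indices are 0-based throughout: the vectors X_1, ..., X_4 of the text are
   X 0, ..., X 3, and the layers V_1, V_2, V_3 are indexed by degree 1, 2, 3.
   A vector of Lie(E) is the row of its coordinates in the basis (X_i), and a
   point of the group is identified with its logarithm, so that exp is the
   identity and both live in 'rV[R]_4. *)

Definition deg (i : 'I_4) : nat := nth 0%N [:: 1; 1; 2; 3]%N i.

Section EngelGroup.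
Variable R : realType.
Implicit Types (x y p q v w : 'rV[R]_4) (Y : 'M[R]_4).

Definition X (i : 'I_4) : 'rV[R]_4 := delta_mx 0 i.

(* Bilinear alternating extension of [X_1,X_2] = X_3, [X_1,X_3] = X_4. *)
Definition bracket x y : 'rV[R]_4 :=
  (x 0 0 * y 0 1 - x 0 1 * y 0 0) *: X 2 +
  (x 0 0 * y 0 2 - x 0 2 * y 0 0) *: X 3.

(* Baker-Campbell-Hausdorff product; the Lie algebra is nilpotent of step 3,
   so the series stops after the brackets of length 3. *)
Definition emul x y : 'rV[R]_4 :=
  x + y + 2^-1 *: bracket x y +
  12^-1 *: (bracket x (bracket x y) + bracket y (bracket y x)).

Definition einv x : 'rV[R]_4 := - x.

(* Value at p of the left invariant vector field equal to v at the unit. *)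
Definition linv v p : 'rV[R]_4 := 'D_v (emul p) 0.

(* The layer V_k as a row space. *)
Definition layer (k : nat) : 'M[R]_4 := (\sum_(i < 4 | deg i == k) <<X i>>)%MS.

(* The rows of Y are the vectors of the basis. *)
Definition graded_basis Y : Prop :=
  Y \in unitmx /\ forall i, (row i Y <= layer (deg i))%MS.

(* g p is the inner product on the tangent space at p.  Smoothness in p need
   not be required: by left invariance g p is the pullback of g 0 under the
   (polynomial) left translation by the inverse of p. *)
Definition left_invariant_metric
    (g : 'rV[R]_4 -> 'rV[R]_4 -> 'rV[R]_4 -> R) : Prop :=
  [/\ forall p (a : R) v v' w, g p (a *: v + v') w = a * g p v w + g p v' w,
      forall p v w, g p v w = g p w v,
      forall p v, v != 0 -> 0 < g p v v &
      forall p q v w,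
        g (emul p q) ('D_v (emul p) q) ('D_w (emul p) q) = g q v w].

Definition orthonormal (g : 'rV[R]_4 -> 'rV[R]_4 -> 'rV[R]_4 -> R) Y : Prop :=
  forall p (i j : 'I_4),
    g p (linv (row i Y) p) (linv (row j Y) p) = (i == j)%:R.

(* MathComp-Analysis's jacobian acts on rows from the right, v |-> v *m J;
   the usual Jacobian matrix is its transpose. *)
Definition Dmx (f : 'rV[R]_2 -> 'rV[R]_4) (u : 'rV[R]_2) : 'M[R]_(4, 2) :=
  (jacobian f u)^T.

Definition C1_on (U : set 'rV[R]_2) (f : 'rV[R]_2 -> 'rV[R]_4) : Prop :=
  forall u, U u -> differentiable f u /\ {for u, continuous (Dmx f)}.

(* Immersion which is a homeomorphism onto its image. *)
Definition C1_embedding (U : set 'rV[R]_2) (f : 'rV[R]_2 -> 'rV[R]_4) : Prop :=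
  [/\ C1_on U f,
      forall u, U u -> \rank (Dmx f u) = 2%N,
      {in U &, injective f} &
      forall V, open V -> V `<=` U ->
        exists2 W, open W & f @` V = f @` U `&` W].

Definition C1_submanifold (S : set 'rV[R]_4) : Prop :=
  forall p, S p -> exists (W : set 'rV[R]_4) (U : set 'rV[R]_2)
      (f : 'rV[R]_2 -> 'rV[R]_4),
    [/\ open W, W p, open U, C1_embedding U f & f @` U = S `&` W].

(* Velocities at p of the curves in S through p. *)
Definition tangent_space (S : set 'rV[R]_4) p : set 'rV[R]_4 :=
  [set v | exists c : R -> 'rV[R]_4,
     [/\ c 0 = p, \forall s \near (0 : R), S (c s) & is_derive (0 : R) 1 c v]].

(* The rows of t form a basis of the tangent space. *)
Definition tangent_basis (S : set 'rV[R]_4) p (t : 'M[R]_(2, 4)) : Prop :=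
  row_free t /\ tangent_space S p = [set v | (v <= t)%MS].

(* Bivectors are represented by antisymmetric matrices. *)
Definition wedge v w : 'M[R]_4 := v^T *m w - w^T *m v.

(* degree_at S p d is d_S(p) = d; the value does not depend on t and Y. *)
Definition degree_at (S : set 'rV[R]_4) p (d : nat) : Prop :=
  exists (t : 'M[R]_(2, 4)) Y (c : 'M[R]_4),
    [/\ tangent_basis S p t,
        graded_basis Y,
        wedge (row 0 t) (row 1 t) =
          \sum_(i < 4) \sum_(j < 4 | (i < j)%N)
             c i j *: wedge (linv (row i Y) p) (linv (row j Y) p) &
        d = (\max_(i < 4) \max_(j < 4 | (i < j) && (c i j != 0%R))
               (deg i + deg j))%N].

Definition has_degree (S : set 'rV[R]_4) (d : nat) : Prop :=
  (exists2 p, S p & degree_at S p d) /\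
  (forall p e, S p -> degree_at S p e -> (e <= d)%N).

Definition ltranslate p (S : set 'rV[R]_4) : set 'rV[R]_4 := emul p @` S.

(* y |-> exp (sum_j y_j Y_j) and its inverse. *)
Definition Fexp Y y : 'rV[R]_4 := \sum_j y 0 j *: row j Y.
Definition Fexp_inv Y x : 'rV[R]_4 := x *m invmx Y.

Lemma FexpK Y : Y \in unitmx ->
  cancel (Fexp Y) (Fexp_inv Y) /\ cancel (Fexp_inv Y) (Fexp Y).
Proof.
by move=> Yu; split=> x; rewrite /Fexp /Fexp_inv -mulmx_sum_row ?mulmxK ?mulmxKV.
Qed.

End EngelGroup.

(* With j = 0, 1, 2 standing for the text's j = 1, 2, 3: nlayer j is n_j,
   mlayer j is m_(j-1) and mucol alpha j is mu_(j-1). *)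
Definition nlayer (j : 'I_3) : nat := nth 0%N [:: 2; 1; 1]%N j.
Definition mlayer (j : 'I_3) : nat := (\sum_(i < 3 | i < j) nlayer i)%N.
Definition mucol (alpha : 'I_3 -> nat) (j : 'I_3) : nat :=
  (\sum_(i < 3 | i < j) alpha i)%N.

Definition special_parametrization (R : realType)
    (g : 'rV[R]_4 -> 'rV[R]_4 -> 'rV[R]_4 -> R) (S : set 'rV[R]_4)
    (alpha : 'I_3 -> nat) (Y : 'M[R]_4) (U : set 'rV[R]_2)
    (Phi : 'rV[R]_2 -> 'rV[R]_4) : Prop :=
  let phi := Fexp_inv Y \o Phi in
  [/\ (forall j, alpha j <= nlayer j)%N /\ (\sum_j alpha j = 2)%N,
      graded_basis Y /\ orthonormal g Y,
      [/\ bounded_set U, open U & U 0],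
      [/\ C1_embedding U Phi, Phi @` U `<=` S & Phi 0 = 0] &
      (forall (j : 'I_3) (s : 'I_4) (k : 'I_2),
         (mlayer j <= s < mlayer j + alpha j)%N ->
         k = (s - mlayer j + mucol alpha j)%N :> nat ->
         forall u, U u -> phi u 0 s = u 0 k)
      /\
      (* entry (s, k) of D phi(0) has local indices s - m, k - mu in the
         (j, i) block *)
      (forall (j i : 'I_3) (s : 'I_4) (k : 'I_2),
         (mlayer j <= s < mlayer j + nlayer j)%N ->
         (mucol alpha i <= k < mucol alpha i + alpha i)%N ->
         [/\ (i < j)%N -> Dmx phi 0 s k = 0,
             i = j ->
               Dmx phi 0 s k = (s - mlayer j == k - mucol alpha i)%N%:R &
             (j < i)%N -> (s - mlayer j < alpha j)%N -> Dmx phi 0 s k = 0])].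

(* Main.v *)
Require Import Defs.
From HB Require Import structures.
From mathcomp Require Import ring lra.

(** A surface of degree at most 3 is an integral surface of a distribution of
    rank 3, and the obstruction to the existence of such surfaces is a bracket
    that has to vanish on their tangent planes.  Indices start at 0.

    Let theta be the left invariant 1-form that takes the value 1 on X_3 and
    kills X_0, X_1 and X_2.  A tangent plane has degree at most 3 exactly when
    its bivector has no component on any Y_i /\ Y_3, that is, when theta vanishes
    on it (mcform_tangent).  Hence theta vanishes on Sigma and, being left
    invariant, along every parametrization Phi of the translate of Sigma by the
    inverse of p.  If Phi were C^2, then 0 = d (Phi^* theta) = Phi^* (d theta);
    as d theta (v, w) = - theta [v, w] for left invariant fields, the bracket of
    two vectors tangent at the unit would have no component on X_3.

    Here Phi is only C^1, so that Phi^* theta cannot be differentiated.  This is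
    overcome by adding an exact form to theta.  For w = Phi_3 + Phi_0 Phi_2 / 2,
    the equation theta = 0 says that every first partial derivative of w has
    the form Phi_0 K, where K involves first derivatives of Phi and is merely
    continuous.  Since Phi_0 vanishes at the origin and is differentiable there,
    Phi_0 K is differentiable at the origin too (diff_mul_near).  Thus w is twice
    differentiable at the origin, its second derivative is symmetric
    (second_derivative_symmetric), and this symmetry is the vanishing of the X_3
    component of the bracket (contact_commute).

    It remains to see which vectors are tangent at the origin.  The number
    alpha 2 is 0 because theta vanishes on the tangent plane, and alpha 0 is
    not 2 because the plane would then be V_1, of degree 2 and not 3
    (degree_horizontal_plane).  So alpha is (1, 1, 0), and the plane is spanned by
    Y_0 and lambda Y_1 + Y_2 for some lambda.  Their bracket is
    lambda xi12 Y_2 + xi13 Y_3, whose X_3 component is a nonzero multiple of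
    xi13. *)

Set Implicit Arguments.
Unset Strict Implicit.
Unset Printing Implicit Defensive.

Section EngelSurfaces.
Variable R : realType.
Implicit Types p q : 'rV[R]_4.

(** * The group law in coordinates *)

Lemma ord4_ind (P : 'I_4 -> Prop) : P 0 -> P 1 -> P 2 -> P 3 -> forall i, P i.
Proof.
move=> P0 P1 P2 P3 [[|[|[|[|//]]]] lt4].
- by rewrite (_ : Ordinal _ = 0) //; apply/val_inj.
- by rewrite (_ : Ordinal _ = 1) //; apply/val_inj.
- by rewrite (_ : Ordinal _ = 2) //; apply/val_inj.
- by rewrite (_ : Ordinal _ = 3) //; apply/val_inj.
Qed.

Lemma row4P (x y : 'rV[R]_4) :
  [/\ x 0 0 = y 0 0, x 0 1 = y 0 1, x 0 2 = y 0 2 & x 0 3 = y 0 3] -> x = y.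
Proof. by move=> [e0 e1 e2 e3]; apply/rowP; exact: ord4_ind. Qed.

Lemma bracketE (x y : 'rV[R]_4) i : bracket x y 0 i =
  (x 0 0 * y 0 1 - x 0 1 * y 0 0) * (i == 2)%:R +
  (x 0 0 * y 0 2 - x 0 2 * y 0 0) * (i == 3)%:R.
Proof. by rewrite /bracket !mxE. Qed.

Let addE (x y : 'rV[R]_4) i : (x + y) 0 i = x 0 i + y 0 i.
Proof. by rewrite mxE. Qed.

Let oppE (x : 'rV[R]_4) i : (- x) 0 i = - x 0 i.
Proof. by rewrite mxE. Qed.

Let scaleE a (x : 'rV[R]_4) i : (a *: x) 0 i = a * x 0 i.
Proof. by rewrite mxE. Qed.

Let zeroE i : (0 : 'rV[R]_4) 0 i = 0.
Proof. by rewrite mxE. Qed.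

Let coordE := (addE, oppE, scaleE, bracketE, zeroE).

(** The differential at x of the left translation by p, applied to w; the last
    two brackets come from the part of the product that is quadratic in x. *)
Definition demul p (x w : 'rV[R]_4) : 'rV[R]_4 := w + 2^-1 *: bracket p w +
  12^-1 *: (bracket p (bracket p w) + bracket w (bracket x p)
     + bracket x (bracket w p)).

(** The Maurer-Cartan form: w, tangent at x, is the value at x of the left
    invariant field equal to mcform x w at the unit.  With A the bracket
    with x, it is the inverse 1 - A/2 + A^2/6 of 1 + A/2 + A^2/12, as A^3 = 0.
    The form theta is its coordinate 3. *)
Definition mcform (x w : 'rV[R]_4) : 'rV[R]_4 :=
  w - 2^-1 *: bracket x w + 6^-1 *: bracket x (bracket x w).

Lemma emul_coords p q : [/\ emul p q 0 0 = p 0 0 + q 0 0,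
  emul p q 0 1 = p 0 1 + q 0 1,
  emul p q 0 2 = p 0 2 + q 0 2 + 2^-1 * (p 0 0 * q 0 1 - p 0 1 * q 0 0) &
  emul p q 0 3 = p 0 3 + q 0 3 + 2^-1 * (p 0 0 * q 0 2 - p 0 2 * q 0 0) +
     12^-1 * ((p 0 0 - q 0 0) * (p 0 0 * q 0 1 - p 0 1 * q 0 0))].
Proof. by split; rewrite /emul !coordE /=; ring. Qed.

Lemma demul_coords p (x w : 'rV[R]_4) : [/\ demul p x w 0 0 = w 0 0,
  demul p x w 0 1 = w 0 1,
  demul p x w 0 2 = w 0 2 + 2^-1 * (p 0 0 * w 0 1 - p 0 1 * w 0 0) &
  demul p x w 0 3 = w 0 3 + 2^-1 * (p 0 0 * w 0 2 - p 0 2 * w 0 0) +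
     12^-1 * ((p 0 0 - x 0 0) * (p 0 0 * w 0 1 - p 0 1 * w 0 0) -
              w 0 0 * (p 0 0 * x 0 1 - p 0 1 * x 0 0))].
Proof. by split; rewrite /demul !coordE /=; ring. Qed.

Lemma mcform_coords (x w : 'rV[R]_4) : [/\ mcform x w 0 0 = w 0 0,
  mcform x w 0 1 = w 0 1,
  mcform x w 0 2 = w 0 2 - 2^-1 * (x 0 0 * w 0 1 - x 0 1 * w 0 0) &
  mcform x w 0 3 = w 0 3 - 2^-1 * (x 0 0 * w 0 2 - x 0 2 * w 0 0) +
     6^-1 * (x 0 0 * (x 0 0 * w 0 1 - x 0 1 * w 0 0))].
Proof. by split; rewrite /mcform !coordE /=; ring. Qed.

Lemma mcform_demul p (x w : 'rV[R]_4) :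
  mcform (emul p x) (demul p x w) = mcform x w.
Proof.
apply: row4P.
move: (emul p x) (emul_coords p x) => y [y0 y1 y2 _].
move: (demul p x w) (demul_coords p x w) => v [v0 v1 v2 v3].
move: (mcform y v) (mcform_coords y v) => m [-> -> -> ->].
move: (mcform x w) (mcform_coords x w) => n [-> -> -> ->].
by rewrite v0 v1 v2 v3 y0 y1 y2; split; field.
Qed.

Lemma demul0_mcform p (w : 'rV[R]_4) : demul p 0 (mcform p w) = w.
Proof.
apply: row4P.
move: (mcform p w) (mcform_coords p w) => v [v0 v1 v2 v3].
move: (demul p 0 v) (demul_coords p 0 v) => m [-> -> -> ->].
by rewrite v0 v1 v2 v3 !zeroE; split; field.
Qed.

Lemma mcform_demul0 p (w : 'rV[R]_4) : mcform p (demul p 0 w) = w.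
Proof.
apply: row4P.
move: (demul p 0 w) (demul_coords p 0 w) => v [v0 v1 v2 v3].
move: (mcform p v) (mcform_coords p v) => m [-> -> -> ->].
by rewrite v0 v1 v2 v3 !zeroE; split; field.
Qed.

Lemma mcform0 (v : 'rV[R]_4) : mcform 0 v = v.
Proof.
apply: row4P; move: (mcform 0 v) (mcform_coords 0 v) => m [-> -> -> ->].
by rewrite !mxE; split; ring.
Qed.

Lemma emul0 p : emul p 0 = p.
Proof.
apply: row4P; move: (emul p 0) (emul_coords p 0) => m [-> -> -> ->].
by rewrite !mxE; split; ring.
Qed.

Lemma emul_einvK p q : emul p (emul (einv p) q) = q.
Proof.
apply: row4P.
move: (emul (einv p) q) (emul_coords (einv p) q) => x; rewrite /einv !oppE.
move=> [x0 x1 x2 x3]; move: (emul p x) (emul_coords p x) => y [-> -> -> ->].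
by rewrite x0 x1 x2 x3; split; field.
Qed.

Fact demul_linear p (x : 'rV[R]_4) : linear (demul p x).
Proof.
move=> a v w; apply: row4P.
move: (demul p x v) (demul_coords p x v) => y1 [v0 v1 v2 v3].
move: (demul p x w) (demul_coords p x w) => y2 [w0 w1 w2 w3].
move: (demul p x (a *: v + w)) (demul_coords p x (a *: v + w)).
move=> y [-> -> -> ->].
rewrite !(addE, scaleE) v0 v1 v2 v3 w0 w1 w2 w3.
by split; ring.
Qed.

HB.instance Definition _ p (x : 'rV[R]_4) :=
  GRing.isLinear.Build R 'rV[R]_4 'rV[R]_4 _ (demul p x) (demul_linear p x).

Fact mcform_linear (x : 'rV[R]_4) : linear (mcform x).
Proof.
move=> a v w; apply: row4P.
move: (mcform x v) (mcform_coords x v) => y1 [v0 v1 v2 v3].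
move: (mcform x w) (mcform_coords x w) => y2 [w0 w1 w2 w3].
move: (mcform x (a *: v + w)) (mcform_coords x (a *: v + w)) => y [-> -> -> ->].
rewrite !(addE, scaleE) v0 v1 v2 v3 w0 w1 w2 w3.
by split; ring.
Qed.

HB.instance Definition _ (x : 'rV[R]_4) :=
  GRing.isLinear.Build R 'rV[R]_4 'rV[R]_4 _ (mcform x) (mcform_linear x).

(** * Graded bases *)

Lemma graded_basis_coord (Y : 'M[R]_4) i j :
  graded_basis Y -> deg i != deg j -> Y i j = 0.
Proof.
move=> [_ /(_ i) Yi] ij.
suff : (layer R (deg i) <= kermx (delta_mx j 0 : 'M[R]_(4, 1)))%MS.
  move/(submx_trans Yi)/sub_kermxP/matrixP/(_ 0 0).
  by rewrite -colE !mxE.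
apply/sumsmx_subP => k /eqP ki; rewrite genmxE; apply/sub_kermxP.
rewrite /X mul_delta_mx_0 //.
by apply: contraNneq ij => <-; rewrite ki.
Qed.

(** The layers V_2 and V_3 are lines, so a graded basis has a single vector in
    each of them, which cannot be zero. *)
Lemma graded_basis_neq0 (Y : 'M[R]_4) k :
  graded_basis Y -> (forall j, j != k -> deg k != deg j) -> Y k k != 0.
Proof.
move=> gY kk; apply/eqP => Yk0; have [Yu _] := gY.
have rk0 : row k Y = 0.
  apply/rowP => j; rewrite !mxE; have [->//|jk] := eqVneq j k.
  by rewrite (graded_basis_coord gY) // kk.
have /matrixP /(_ 0 k) : row k Y *m invmx Y = delta_mx 0 k.
  by rewrite rowE -mulmxA mulmxV // mulmx1.
by rewrite rk0 mul0mx !mxE !eqxx => /esym/eqP; rewrite oner_eq0.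
Qed.

Lemma graded_basis_diag (Y : 'M[R]_4) :
  graded_basis Y -> Y 2 2 != 0 /\ Y 3 3 != 0.
Proof.
by move=> gY; split; apply: (graded_basis_neq0 gY) => -[[|[|[|[|//]]]]] ?.
Qed.

Lemma graded_basis1 : graded_basis (1%:M : 'M[R]_4).
Proof.
split=> [|i]; first exact: unitmx1.
by rewrite row1 (sumsmx_sup i) // genmxE.
Qed.

Lemma graded_basis_mul (Y : 'M[R]_4) (z : 'rV[R]_4) : graded_basis Y ->
  (z *m Y) 0 2 = z 0 2 * Y 2 2 /\ (z *m Y) 0 3 = z 0 3 * Y 3 3.
Proof.
move=> gY; split; rewrite !mxE; [rewrite (bigD1 2)|rewrite (bigD1 3)] => //=;
  rewrite big1 ?addr0 // => i i2; rewrite (graded_basis_coord gY) ?mulr0 //;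
  by move: i i2 => [[|[|[|[|//]]]]].
Qed.

(** * Differentiating the group law along curves *)

Lemma is_derive_rowP (V : normedModType R) n (M : V -> 'rV[R]_n)
    (dM : 'rV[R]_n) (t v : V) :
  is_derive t v M dM <->
  forall j, is_derive t v (fun x => M x 0 j) (dM 0 j).
Proof.
split=> [[dM1 dM2] j|dj].
  apply: DeriveDef; first by move/derivable_mxP : dM1; apply.
  by move: dM2; rewrite derive_mx // => <-; rewrite mxE.
have dM1 : derivable M t v.
  by apply/derivable_mxP => i j; rewrite (ord1 i); have [] := dj j.
apply: DeriveDef => //; rewrite derive_mx //; apply/rowP => j; rewrite mxE.
by have [] := dj j.
Qed.

Let is_derive_emul2 (f0 f1 f2 : R -> R) (b a0 a1 a2 s d0 d1 d2 : R) :
  is_derive s 1 f0 d0 -> is_derive s 1 f1 d1 -> is_derive s 1 f2 d2 ->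
  is_derive s 1 (fun x => a2 + f2 x + b * (a0 * f1 x - a1 * f0 x))
    (d2 + b * (a0 * d1 - a1 * d0)).
Proof.
move=> h0 h1 h2; rewrite -[X in X + b * _]add0r.
have hB := is_deriveB (is_deriveZ a0 h1) (is_deriveZ a1 h0).
exact: is_deriveD (is_deriveD (is_derive_cst a2 s 1) h2) (is_deriveZ b hB).
Qed.

Let is_derive_emul3 (f0 f1 f2 f3 : R -> R) (b c a0 a1 a2 a3 s d0 d1 d2 d3 : R) :
  is_derive s 1 f0 d0 -> is_derive s 1 f1 d1 -> is_derive s 1 f2 d2 ->
  is_derive s 1 f3 d3 ->
  is_derive s 1 (fun x => a3 + f3 x + b * (a0 * f2 x - a2 * f0 x)
      + c * ((a0 - f0 x) * (a0 * f1 x - a1 * f0 x)))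
    (d3 + b * (a0 * d2 - a2 * d0)
      + c * ((a0 - f0 s) * (a0 * d1 - a1 * d0) - d0 * (a0 * f1 s - a1 * f0 s))).
Proof.
move=> h0 h1 h2 h3.
have hB := is_deriveB (is_deriveZ a0 h1) (is_deriveZ a1 h0).
have hM := is_deriveM (is_deriveB (is_derive_cst a0 s 1) h0) hB.
have h := is_deriveD (is_derive_emul2 b a0 a2 a3 h0 h2 h3) (is_deriveZ c hM).
apply: (is_derive_eq h); congr (_ + _ * _).
rewrite sub0r [X in _ + X = _](_ : _ = (a0 * f1 s - a1 * f0 s) * - d0) //.
by rewrite mulrN mulrC [d0 * _]mulrC.
Qed.

Lemma is_derive_emul p (c : R -> 'rV[R]_4) (s : R) (v : 'rV[R]_4) :
  is_derive s 1 c v -> is_derive s 1 (emul p \o c) (demul p (c s) v).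
Proof.
move=> /is_derive_rowP dc; apply/is_derive_rowP.
have d0 := dc 0; have d1 := dc 1; have d2 := dc 2; have d3 := dc 3.
move: (demul p (c s) v) (demul_coords p (c s) v) => m [m0 m1 m2 m3].
suff : [/\ is_derive s 1 (fun x => emul p (c x) 0 0) (m 0 0),
   is_derive s 1 (fun x => emul p (c x) 0 1) (m 0 1),
   is_derive s 1 (fun x => emul p (c x) 0 2) (m 0 2) &
   is_derive s 1 (fun x => emul p (c x) 0 3) (m 0 3)].
  by move=> [e0 e1 e2 e3]; exact: ord4_ind.
split.
- rewrite m0 (_ : (fun x => _) = cst (p 0 0) + (fun x => c x 0 0)).
    by rewrite -[X in is_derive _ _ _ X]add0r; exact: is_deriveD.
  by apply/funext => x; have [-> _ _ _] := emul_coords p (c x).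
- rewrite m1 (_ : (fun x => _) = cst (p 0 1) + (fun x => c x 0 1)).
    by rewrite -[X in is_derive _ _ _ X]add0r; exact: is_deriveD.
  by apply/funext => x; have [_ -> _ _] := emul_coords p (c x).
- have := is_derive_emul2 2^-1 (p 0 0) (p 0 1) (p 0 2) d0 d1 d2.
  rewrite -m2; congr (is_derive _ _ _ _); apply/funext => x.
  by have [_ _ -> _] := emul_coords p (c x).
- have := is_derive_emul3 2^-1 12^-1 (p 0 0) (p 0 1) (p 0 2) (p 0 3)
    d0 d1 d2 d3.
  rewrite -m3; congr (is_derive _ _ _ _); apply/funext => x.
  by have [_ _ _ ->] := emul_coords p (c x).
Qed.

(** Directional derivatives are derivatives along lines, so those of a composite
    follow from the derivatives of curves. *)
Lemma is_derive_lineP (V W : normedModType R) (f : V -> W) (x v : V) (s : R)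
    (df : W) :
  is_derive s 1 (fun t => f (x + t *: v)) df <-> is_derive (x + s *: v) v f df.
Proof.
have E : (fun h : R => h^-1 *: ((f \o shift (x + s *: v)) (h *: v)
      - f (x + s *: v))) =
    (fun h : R => h^-1 *: (((fun t => f (x + t *: v)) \o shift s) (h *: 1)
      - f (x + s *: v))).
  apply/funext => h; congr (_ *: (f _ - f _)).
  by rewrite /= [h *: 1]mulr1 scalerDl addrCA addrC addrAC.
by split=> -[d1 d2]; apply: DeriveDef; rewrite /derivable /derive /= ?E // -E.
Qed.

Lemma linvE (v p : 'rV[R]_4) : linv v p = demul p 0 v.
Proof.
have d0 : is_derive (0 : R) 1 (fun s => 0 + s *: v) v.
  exact: (iffRL (is_derive_lineP (@id 'rV[R]_4) 0 v 0 v) (is_derive_id _ _)).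
have := @is_derive_emul p (fun s => 0 + s *: v) 0 v d0.
by move/(is_derive_lineP (emul p)); rewrite scale0r addr0 => -[].
Qed.

Lemma derivable_line n (f : 'rV[R]_n -> 'rV[R]_4) (x v : 'rV[R]_n) :
  differentiable f x ->
  is_derive (0 : R) 1 (fun s => f (x + s *: v)) ('D_v f x).
Proof.
move=> df; apply: (iffRL (is_derive_lineP f x v 0 _)); rewrite scale0r addr0.
by apply: derivableP; exact: diff_derivable.
Qed.

Lemma near_line n (U : set 'rV[R]_n) (x v : 'rV[R]_n) :
  open U -> U x -> \forall s \near (0 : R), U (x + s *: v).
Proof.
move=> oU Ux; have [dl _] : is_derive (0 : R) 1 (fun s => x + s *: v) v.
  exact: (iffRL (is_derive_lineP (@id 'rV[R]_n) x v 0 v) (is_derive_id _ _)).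
have : (fun s : R => x + s *: v) @ 0 --> x + (0 : R) *: v.
  by have /derivable1_diffP/differentiable_continuous := dl; exact.
by rewrite scale0r addr0 => /(_ _ (open_nbhs_nbhs (conj oU Ux))).
Qed.

(** * Symmetry of the second derivative *)

(** The second difference of w over the parallelogram spanned by h a and h b is
    h^2 times the derivative along b of wa, up to o(h^2): the mean value theorem
    along a reduces it to h times a difference of two values of wa. *)
Lemma second_difference (V : normedModType R) (w wa : V -> R)
    (L : {linear V -> R}) (x a b : V) :
  (\forall u \near x, is_derive u a w (wa u)) ->
  (forall e, 0 < e ->
     \forall u \near x, `|wa u - wa x - L (u - x)| <= e * `|u - x|) ->
  forall e, 0 < e -> \forall h \near 0^'+,
    `|w (x + h *: a + h *: b) - w (x + h *: a) - (w (x + h *: b) - w x)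
       - h ^+ 2 * L b| <= e * h ^+ 2.
Proof.
move=> dw waL e e0.
(* h (|a| + |b| + 1) bounds the distance from x to the parallelogram. *)
have M0 : 0 < `|a| + `|b| + 1 by rewrite ltr_wpDl ?addr_ge0.
have e'0 : 0 < e / (2 * (`|a| + `|b| + 1)) by rewrite divr_gt0 ?mulr_gt0.
have /nbhs_ballP[r /= r0 ball_r] : \forall u \near x, is_derive u a w (wa u) /\
    `|wa u - wa x - L (u - x)| <= e / (2 * (`|a| + `|b| + 1)) * `|u - x|.
  by apply: filterI => //; exact: waL.
near=> h.
have h0 : 0 < h by [].
have hr : h * (`|a| + `|b| + 1) < r.
  by rewrite -ltr_pdivlMr //; near: h; apply: nbhs_right_lt; rewrite divr_gt0.
have near_x s t : 0 <= s <= h -> 0 <= t <= h ->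
    let u := x + t *: b + s *: a in
    is_derive u a w (wa u) /\
    `|wa u - wa x - L (u - x)| <= e / 2 * h.
  move=> /andP[s0 sh] /andP[t0 th] u.
  have ux : `|u - x| <= h * (`|a| + `|b| + 1).
    rewrite /u -[x + _ + _]addrA [x + _]addrC addrK.
    apply: le_trans (ler_normD _ _) _.
    rewrite !normrZ !ger0_norm // mulrDr mulr1 mulrDr addrC.
    apply: le_trans (lerD (ler_wpM2r _ sh) (ler_wpM2r _ th)) _ => //.
    by rewrite lerDl ltW.
  have [|d1 d2] := ball_r u.
    by rewrite -ball_normE /= distrC; apply: le_lt_trans hr.
  split=> //; apply: le_trans d2 _.
  apply: le_trans (ler_wpM2l (ltW e'0) ux) _.
  by rewrite le_eqVlt; apply/orP; left; apply/eqP; field; rewrite gt_eqF.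
pose G s : R := w (x + h *: b + s *: a) - w (x + s *: a).
pose dG s : R := wa (x + h *: b + s *: a) - wa (x + s *: a).
have GdG s : 0 <= s <= h -> is_derive s 1 G (dG s).
  move=> sh; apply: is_deriveB; apply/is_derive_lineP.
    by have [|] := near_x s h sh; first by rewrite lexx ltW.
  have [|+ _] := near_x s 0 sh; first by rewrite lexx ltW.
  by rewrite scale0r addr0.
have [||c ch] := @MVT R G dG 0 h h0.
- by move=> s /itvP sh; apply: GdG; rewrite !sh.
- apply: derivable_within_continuous => s /itvP sh.
  by have [] := GdG s; rewrite ?sh.
rewrite {1 2}/G !scale0r !addr0 subr0 [x + h *: a + _]addrAC => ->.
have ch' : 0 <= c <= h by rewrite !(itvP ch).
have [|_ l1] := near_x c h ch'; first by rewrite lexx ltW.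
have [|_] := near_x c 0 ch'; first by rewrite lexx ltW.
rewrite scale0r addr0 => l2.
have -> : dG c * h - h ^+ 2 * L b = h *
    ((wa (x + h *: b + c *: a) - wa x - L (x + h *: b + c *: a - x))
     - (wa (x + c *: a) - wa x - L (x + c *: a - x))).
  by rewrite /dG !raddfB !raddfD /= !linearZ /= /GRing.scale /=; ring.
rewrite normrM gtr0_norm // expr2 mulrCA ler_pM2l //.
by apply: le_trans (ler_normB _ _) _; apply: le_trans (lerD l1 l2) _; lra.
Unshelve. all: by end_near. Qed.

(** The second difference does not change when a and b are exchanged, so its
    two expansions agree.  Neither wa nor wb has to be continuous away from x:
    a first order expansion at x is enough. *)
Lemma second_derivative_symmetric (V : normedModType R) (w wa wb : V -> R)
    (La Lb : {linear V -> R}) (x a b : V) :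
  (\forall u \near x, is_derive u a w (wa u)) ->
  (\forall u \near x, is_derive u b w (wb u)) ->
  (forall e, 0 < e ->
     \forall u \near x, `|wa u - wa x - La (u - x)| <= e * `|u - x|) ->
  (forall e, 0 < e ->
     \forall u \near x, `|wb u - wb x - Lb (u - x)| <= e * `|u - x|) ->
  La b = Lb a.
Proof.
move=> dwa dwb waL wbL; apply/eqP; rewrite -subr_eq0 -normr_eq0 eq_le normr_ge0.
rewrite andbT; apply/ler_addgt0Pr => e e0; rewrite add0r.
have e20 : 0 < e / 2 by rewrite divr_gt0.
have [h [ha [hb h0]]] := filter_ex (filterI (second_difference b dwa waL e20)
  (filterI (second_difference a dwb wbL e20) (nbhs_right_gt (0 : R)))).
move: ha hb; rewrite [x + h *: b + _]addrAC.
set z := w (x + h *: a + h *: b); set za := w (x + h *: a).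
set zb := w (x + h *: b) => ha hb.
have h20 : 0 < h ^+ 2 by rewrite exprn_gt0.
rewrite -(ler_pM2l h20) -{1}(gtr0_norm h20) -normrM.
have -> : h ^+ 2 * (La b - Lb a) = (z - zb - (za - w x) - h ^+ 2 * Lb a)
  - (z - za - (zb - w x) - h ^+ 2 * La b) by ring.
by apply: le_trans (ler_normB _ _) _; apply: le_trans (lerD hb ha) _; lra.
Qed.

Lemma diff_near (V W : normedModType R) (f : V -> W) (x : V) :
  differentiable f x -> forall e, 0 < e ->
  \forall u \near x, `|f u - f x - 'd f x (u - x)| <= e * `|u - x|.
Proof.
move=> df e e0; have /diffP[_ E] := df.
have {}E : f = (fun u => f x + 'd f x (u - x)) +o_ (nbhs x) (center x).
  by apply/eqaddoE; rewrite [LHS](funext E) lim_id.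
have /eqaddoP/(_ e e0) := E; apply: filterS => u /=.
by rewrite opprD addrA.
Qed.

(** A factor K that is merely continuous at x is enough, since f is of first
    order at x: f u (K u - K x) is o(u - x). *)
Lemma diff_mul_near (V : normedModType R) (f K : V -> R) (x : V) :
  differentiable f x -> f x = 0 -> {for x, continuous K} ->
  forall e, 0 < e ->
  \forall u \near x, `|f u * K u - f x * K x - (K x \*: 'd f x) (u - x)|
     <= e * `|u - x|.
Proof.
move=> df fx0 cK e e0; rewrite fx0 mul0r.
have [k k0 dfk] := linear_lipschitz (diff_continuous df).
pose e1 := e / 2 / (k + 1); pose e2 := e / 2 / (`|K x| + 1).
have k1 : 0 < k + 1 by rewrite addr_gt0.
have Kx1 : 0 < `|K x| + 1 by rewrite ltr_wpDl.
have e10 : 0 < e1 by rewrite !divr_gt0.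
have e20 : 0 < e2 by rewrite !divr_gt0.
have /cvgrPdist_le/(_ _ e10) nK := cK.
near=> u.
have df1 : `|f u - 'd f x (u - x)| <= 1 * `|u - x|.
  rewrite -[f u]subr0 -fx0; near: u; exact: diff_near.
have df2 : `|f u - 'd f x (u - x)| <= e2 * `|u - x|.
  rewrite -[f u]subr0 -fx0; near: u; exact: diff_near.
have Ku : `|K u - K x| <= e1 by rewrite distrC; near: u.
have -> : f u * K u - 0 - (K x \*: 'd f x) (u - x)
   = f u * (K u - K x) + K x * (f u - 'd f x (u - x)).
  by rewrite /GRing.scale_fun /GRing.scale /=; ring.
have fu : `|f u| <= (k + 1) * `|u - x|.
  rewrite -[f u](subrK ('d f x (u - x))) addrC mulrDl.
  by apply: le_trans (ler_normD _ _) _; apply: lerD.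
apply: le_trans (ler_normD _ _) _; rewrite !normrM.
rewrite [e]splitr mulrDl; apply: lerD.
  apply: le_trans (ler_pM _ _ fu Ku) _ => //.
  by rewrite /e1 le_eqVlt; apply/orP; left; apply/eqP; field; rewrite gt_eqF.
apply: le_trans (ler_pM _ _ (lexx _) df2) _ => //.
apply: (@le_trans _ _ ((`|K x| + 1) * (e2 * `|u - x|))).
  by rewrite ler_wpM2r ?lerDl // mulr_ge0 // ltW.
by rewrite /e2 le_eqVlt; apply/orP; left; apply/eqP; field; rewrite gt_eqF.
Unshelve. all: by end_near. Qed.

(** * Integral surfaces of theta = 0 *)

(** On an integral surface d theta vanishes, here for a map with derivatives
    that are only continuous at x.  By theta = 0, the derivative along a of
    w = Phi_3 + Phi_0 Phi_2 / 2 is the product of Phi_0 and of a function that is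
    continuous at x with value A_2, so that the second derivative of w at x in
    the directions a, b is A_2 B_0.  Its symmetry reads A_2 B_0 = B_2 A_0. *)
Lemma contact_commute (V : normedModType R) (Phi A B : V -> 'rV[R]_4)
    (x a b : V) :
  Phi x = 0 -> differentiable Phi x ->
  (\forall u \near x, is_derive u a Phi (A u)) ->
  (\forall u \near x, is_derive u b Phi (B u)) ->
  (forall j, {for x, continuous (fun u => A u 0 j : R)}) ->
  (forall j, {for x, continuous (fun u => B u 0 j : R)}) ->
  (\forall u \near x, mcform (Phi u) (A u) 0 3 = 0) ->
  (\forall u \near x, mcform (Phi u) (B u) 0 3 = 0) ->
  bracket (A x) (B x) 0 3 = 0.
Proof.
move=> Phi0 dPhi dA dB cA cB hA hB.
pose f u : R := Phi u 0 0.
pose w u : R := Phi u 0 3 + 2^-1 * (Phi u 0 0 * Phi u 0 2).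
pose K (C : V -> 'rV[R]_4) u : R :=
  C u 0 2 - 6^-1 * (Phi u 0 0 * C u 0 1 - Phi u 0 1 * C u 0 0).
have cPhi : {for x, continuous Phi} := differentiable_continuous dPhi.
have Phic j : {for x, continuous (fun u => Phi u 0 j : R)}.
  apply: (@continuous_comp _ _ _ Phi (fun M : 'rV[R]_4 => M 0 j) x cPhi).
  exact: coord_continuous.
have f0 : f x = 0 by rewrite /f Phi0 mxE.
have df : differentiable f x.
  apply: (@differentiable_comp _ _ _ _ Phi
    (fun M : 'rV[R]_4 => M 0 0 : R) x dPhi).
  exact: differentiable_coord.
have dw (C : V -> 'rV[R]_4) c :
    (\forall u \near x, is_derive u c Phi (C u)) ->
    (\forall u \near x, mcform (Phi u) (C u) 0 3 = 0) ->
    \forall u \near x, is_derive u c w (f u * K C u).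
  move=> dC hC; near=> u.
  have /is_derive_rowP dCu : is_derive u c Phi (C u) by near: u.
  have : mcform (Phi u) (C u) 0 3 = 0 by near: u.
  have [_ _ _ ->] := mcform_coords (Phi u) (C u).
  have := is_deriveD (dCu 3) (is_deriveZ 2^-1 (is_deriveM (dCu 0) (dCu 2))).
  move=> dwu mc0; apply: (is_derive_eq dwu).
  rewrite /GRing.scale /= /f /K; apply/eqP; rewrite -subr_eq0 -[X in _ == X]mc0.
  by apply/eqP; field.
have cK (C : V -> 'rV[R]_4) :
    (forall j, {for x, continuous (fun u => C u 0 j : R)}) ->
    {for x, continuous (K C)}.
  move=> cC; apply: continuousB => //.
  apply: continuousM; first exact: cst_continuous.
  by apply: continuousB; apply: continuousM.
have Kx C : K C x = C x 0 2 by rewrite /K Phi0 !mxE; ring.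
have dfc c C : (\forall u \near x, is_derive u c Phi (C u)) ->
    'd f x c = C x 0 0.
  move=> /nbhs_singleton /is_derive_rowP /(_ 0) dC.
  by rewrite -deriveE // derive_val.
have := second_derivative_symmetric (dw _ _ dA hA) (dw _ _ dB hB)
  (diff_mul_near df f0 (cK A cA)) (diff_mul_near df f0 (cK B cB)).
rewrite /GRing.scale_fun /= (dfc _ _ dA) (dfc _ _ dB) !Kx /GRing.scale /= => AB.
rewrite /bracket !mxE /= !mulr0 !mulr1 add0r.
by apply/eqP; rewrite subr_eq0 mulrC -AB.
Unshelve. all: by end_near. Qed.

Lemma contact_bracket (U : set 'rV[R]_2) (Phi : 'rV[R]_2 -> 'rV[R]_4) :
  open U -> U 0 -> C1_on U Phi -> Phi 0 = 0 ->
  (forall u k, U u -> mcform (Phi u) (row k (jacobian Phi u)) 0 3 = 0) ->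
  bracket (row 0 (jacobian Phi 0)) (row 1 (jacobian Phi 0)) 0 3 = 0.
Proof.
move=> oU U0 PhiC1 Phi0 hPhi; have [dPhi0 cD] := PhiC1 0 U0.
have nU : \forall u \near (0 : 'rV[R]_2), U u.
  exact: open_nbhs_nbhs (conj oU U0).
have Jderiv k : \forall u \near (0 : 'rV[R]_2),
    is_derive u (delta_mx 0 k) Phi (row k (jacobian Phi u)).
  apply: filterS nU => u /PhiC1[du _]; rewrite rowE -deriveEjacobian //.
  by apply: derivableP; exact: diff_derivable.
have Jcont k j : {for (0 : 'rV[R]_2),
    continuous (fun u => row k (jacobian Phi u) 0 j : R)}.
  rewrite (_ : (fun u => _) = (fun u => Dmx Phi u j k)); last first.
    by apply/funext => u; rewrite !mxE.
  apply: (@continuous_comp _ _ _ (Dmx Phi)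
    (fun N : 'M[R]_(4, 2) => N j k) 0 cD).
  exact: coord_continuous.
have Jcontact k : \forall u \near (0 : 'rV[R]_2),
    mcform (Phi u) (row k (jacobian Phi u)) 0 3 = 0.
  by apply: filterS nU => u; exact: hPhi.
exact: (contact_commute Phi0 dPhi0 (Jderiv 0) (Jderiv 1) (Jcont 0)
  (Jcont 1) (Jcontact 0) (Jcontact 1)).
Qed.

(** * Tangent spaces of parametrized surfaces *)

Lemma mulmx_lipschitz m n (M : 'M[R]_(m, n)) :
  exists2 k, 0 < k & forall x : 'rV[R]_m, `|x *m M| <= k * `|x|.
Proof.
exists (\sum_i `|row i M| + 1); first by rewrite ltr_wpDl ?sumr_ge0.
move=> x; rewrite mulmx_sum_row; apply: le_trans (ler_norm_sum _ _ _) _.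
rewrite mulrDl mul1r ler_wpDr // mulr_suml; apply: ler_sum => i _.
rewrite normrZ mulrC ler_wpM2l // [leRHS]/Num.Def.normr /= mx_normrE.
exact: (le_bigmax _ (fun ij => `|x ij.1 ij.2|) (0, i)).
Qed.

Lemma mulmx_continuous m n (M : 'M[R]_(m, n)) :
  continuous (fun x : 'rV[R]_m => x *m M).
Proof.
have [k k0 boundM] := mulmx_lipschitz M.
move=> x; apply/(@cvgrPdist_le _ _ _ (nbhs (x : 'rV[R]_m))) => e e0.
have := nbhsx_ballx x (e / k) (divr_gt0 e0 k0).
apply: filterS => y; rewrite -ball_normE /= => /ltW xy.
rewrite -mulmxBl; apply: le_trans (boundM _) _.
by rewrite mulrC -ler_pdivlMr.
Qed.

Lemma jacobian_mulmxr n m k (f : 'rV[R]_n -> 'rV[R]_m) (M : 'M[R]_(m, k)) x :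
  differentiable f x -> jacobian (fun u => f u *m M) x = jacobian f x *m M.
Proof.
move=> df; have cM : continuous (mulmxr M : 'rV[R]_m -> 'rV[R]_k).
  exact: mulmx_continuous.
have dM : differentiable (mulmxr M : 'rV[R]_m -> 'rV[R]_k) (f x).
  exact: linear_differentiable.
apply/row_matrixP => i; rewrite row_mul !rowE /jacobian !mul_rV_lin1.
by rewrite (diff_comp df dM) /= diff_lin.
Qed.

(** A curve in the image of an embedding lifts, and the lift is continuous at 0
    because f maps open sets to open subsets of its image. *)
Lemma embedding_lift n m (U : set 'rV[R]_n) (f : 'rV[R]_n -> 'rV[R]_m)
    (u0 : 'rV[R]_n) (c : R -> 'rV[R]_m) :
  open U -> U u0 -> {in U &, injective f} ->
  (forall V, open V -> V `<=` U ->
     exists2 W, open W & f @` V = f @` U `&` W) ->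
  c @ 0 --> f u0 -> (\forall s \near (0 : R), (f @` U) (c s)) ->
  exists2 l : R -> 'rV[R]_n, l @ 0 --> u0 &
    \forall s \near (0 : R), f (l s) = c s.
Proof.
move=> oU U0 finj fopen cc cfU.
pose l s := xget u0 [set u | U u /\ f u = c s].
have nl : \forall s \near (0 : R), U (l s) /\ f (l s) = c s.
  near=> s; apply: (@xgetPex _ u0 [set u | U u /\ f u = c s]).
  have [u Uu fu] : (f @` U) (c s) by near: s.
  by exists u.
have cl : l @ (0 : R) --> u0.
  move=> N; rewrite nbhsE => -[N' [oN' N'u0] N'N].
  have [W' oW' fN'] := fopen (N' `&` U) (openI oN' oU) (@subIsetr _ _ _).
  have W'q : W' (f u0).
    by have [] : (f @` U `&` W') (f u0) by rewrite -fN'; exists u0.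
  have cW' : \forall s \near (0 : R), W' (c s).
    exact: (cc _ (open_nbhs_nbhs (conj oW' W'q))).
  suff : \forall s \near (0 : R), N (l s) by [].
  near=> s; apply: N'N.
  have [Uls fls] : U (l s) /\ f (l s) = c s by near: s.
  have [u [N'u Uu] fu] : (f @` (N' `&` U)) (c s).
    by rewrite fN'; split; [exists (l s)|near: s].
  by rewrite (finj (l s) u) ?inE // fls fu.
exists l; first exact: cl.
by apply: filterS nl => s [].
Unshelve. all: by end_near. Qed.

(** As the Jacobian J has a right inverse P, the expansion of f bounds l s - u0
    by a multiple of c s - f u0, which is O(s).  So the error of that expansion
    along l is o(s), and the velocity v is killed by Q = 1 - P J, as J is. *)
Lemma velocity_sub_jacobian n m (f : 'rV[R]_n -> 'rV[R]_m) (u0 : 'rV[R]_n)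
    (c : R -> 'rV[R]_m) (v : 'rV[R]_m) (l : R -> 'rV[R]_n) :
  differentiable f u0 -> row_free (jacobian f u0) ->
  c 0 = f u0 -> is_derive (0 : R) 1 c v -> l @ 0 --> u0 ->
  (\forall s \near (0 : R), f (l s) = c s) -> (v <= jacobian f u0)%MS.
Proof.
move=> df; set J := jacobian f u0 => Jfree c0 dc lu0 fl.
have [P JP] := row_freeP Jfree.
pose Q := 1%:M - P *m J.
have JQ : J *m Q = 0 by rewrite mulmxBr mulmx1 mulmxA JP mul1mx subrr.
suff vQ : v *m Q = 0.
  apply/submxP; exists (v *m P); apply/eqP.
  by rewrite -subr_eq0 -mulmxA -{1}[v]mulmx1 -mulmxBr -/Q vQ.
have [kP kP0 boundP] := mulmx_lipschitz P.
have [kQ kQ0 boundQ] := mulmx_lipschitz Q.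
(* For every small e the estimates below give |v Q| <= C e. *)
pose C := kQ * (1 + 2 * kP * (`|v| + 1)).
have v1 : 0 < `|v| + 1 by rewrite ltr_wpDl.
have C0 : 0 < C.
  apply: mulr_gt0 => //; apply: addr_gt0 => //; apply: mulr_gt0 => //.
  exact: mulr_gt0.
apply/eqP; rewrite -normr_eq0 eq_le normr_ge0 andbT.
apply/ler_addgt0Pr => t t0; rewrite add0r.
pose e := Num.min (Num.min 1 (1 / (2 * kP))) (t / C).
have e0 : 0 < e.
  rewrite /e !lt_min ltr01 /=; apply/andP; split; last exact: divr_gt0.
  by apply: divr_gt0 => //; exact: mulr_gt0.
have e1 : e <= 1 by rewrite /e !ge_min lexx.
have eP : kP * e <= 1 / 2.
  have : e <= 1 / (2 * kP) by rewrite /e !ge_min lexx orbT.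
  by rewrite ler_pdivlMr ?mulr_gt0 // => h; lra.
have eC : C * e <= t.
  have : e <= t / C by rewrite /e !ge_min lexx !orbT.
  by rewrite ler_pdivlMr // mulrC.
apply: le_trans eC.
have [] := dc => /cvg_ex[v' cv'] vE; have {cv'} : (fun h : R => h^-1 *:
    ((c \o shift 0) (h *: 1) - c 0)) @ 0^' --> v.
  by rewrite -vE; apply/cvg_ex; exists v'.
move=> /cvgrPdist_le/(_ e e0) cv.
have nf : \forall s \near (0 : R)^',
    `|f (l s) - f u0 - 'd f u0 (l s - u0)| <= e * `|l s - u0|.
  have nf0 : \forall s \near (0 : R),
    `|f (l s) - f u0 - 'd f u0 (l s - u0)| <= e * `|l s - u0|.
    exact: (lu0 _ (diff_near df e0)).
  by rewrite near_withinE; apply: filterS nf0.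
have nv : \forall s \near (0 : R)^', `|v - s^-1 *: (c s - f u0)| <= e.
  by apply: filterS cv => s; rewrite /= addr0 [s *: 1]mulr1 c0.
have fl' : \forall s \near (0 : R)^', f (l s) = c s.
  by rewrite near_withinE; apply: filterS fl.
have [s [s_neq0 [fls [fs vs]]]] := filter_ex
  (filterI (nbhs_dnbhs_neq (0 : R)) (filterI fl' (filterI nf nv))).
move: fs; rewrite -deriveE // deriveEjacobian // -/J fls.
set q := f u0 in vs *; set d := l s - u0; move=> fs.
pose r := c s - q - d *m J.
have dE : d = (c s - q) *m P - r *m P.
  by rewrite -mulmxBl opprB addrC subrK -mulmxA JP mulmx1.
have dle : `|d| <= 2 * kP * `|c s - q|.
  have : `|d| <= kP * `|c s - q| + kP * (e * `|d|).
    rewrite {1}dE; apply: le_trans (ler_normB _ _) _; apply: lerD => //.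
    by apply: le_trans (boundP r) _; rewrite ler_pM2l.
  have : kP * e * `|d| <= 1 / 2 * `|d| by rewrite ler_wpM2r.
  by rewrite [kP * (_ * _)]mulrA; lra.
have cQ : (c s - q) *m Q = r *m Q.
  by rewrite /r [RHS]mulmxBl -mulmxA JQ mulmx0 subr0.
have cs : `|s^-1 *: (c s - q)| <= `|v| + 1.
  rewrite -[_ *: _](subrK v) addrC; apply: le_trans (ler_normD _ _) _.
  by rewrite lerD2l distrC; apply: le_trans e1.
have sd : `|s|^-1 * `|d| <= 2 * kP * (`|v| + 1).
  apply: (@le_trans _ _ (2 * kP * (`|s|^-1 * `|c s - q|))).
    by rewrite mulrCA ler_pM2l ?invr_gt0 ?normr_gt0.
  by rewrite ler_pM2l ?mulr_gt0 // -normfV -normrZ.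
have -> : v *m Q = (v - s^-1 *: (c s - q)) *m Q + s^-1 *: (r *m Q).
  by rewrite -cQ mulmxBl -scalemxAl subrK.
apply: le_trans (ler_normD _ _) _; rewrite normrZ normfV.
apply: (@le_trans _ _ (kQ * e + `|s|^-1 * (kQ * (e * `|d|)))).
  apply: lerD; first by apply: le_trans (boundQ _) _; rewrite ler_pM2l.
  rewrite ler_wpM2l ?invr_ge0 //; apply: le_trans (boundQ _) _.
  by rewrite ler_pM2l.
rewrite [leLHS](_ : _ = kQ * e * (1 + `|s|^-1 * `|d|)); last by ring.
rewrite /C [leRHS]mulrAC ler_pM2l ?lerD2l //; exact: mulr_gt0.
Qed.

Lemma tangent_basis_chart (S W : set 'rV[R]_4) (U : set 'rV[R]_2)
    (f : 'rV[R]_2 -> 'rV[R]_4) (u0 : 'rV[R]_2) :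
  open W -> W (f u0) -> open U -> U u0 -> C1_embedding U f ->
  f @` U = S `&` W -> tangent_basis S (f u0) (jacobian f u0).
Proof.
move=> oW Wq oU U0 [fC1 frk finj fopen] fU.
have [df _] := fC1 _ U0; set J := jacobian f u0.
have Jfree : row_free J.
  by rewrite /row_free -mxrank_tr; apply/eqP; exact: frk.
have fS u : U u -> S (f u).
  by move=> Uu; have [] : (S `&` W) (f u) by rewrite -fU; exists u.
split=> //; apply/seteqP; split=> v /=; last first.
  move=> /submxP[h ->]; exists (fun s => f (u0 + s *: h)).
  split; first by rewrite scale0r addr0.
    by apply: filterS (near_line h oU U0) => s; exact: fS.
  by rewrite -deriveEjacobian //; exact: derivable_line.
move=> [c [c0 cS dc]].
have cc : c @ 0 --> f u0.
  rewrite -c0; have [/derivable1_diffP/differentiable_continuous + _] := dc.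
  exact.
have cW : \forall s \near 0, W (c s).
  exact: (cc _ (open_nbhs_nbhs (conj oW Wq))).
have [|l lu0 fl] := embedding_lift oU U0 finj fopen cc.
  by near=> s; rewrite fU; split; near: s.
exact: (velocity_sub_jacobian df Jfree c0 dc lu0 fl).
Unshelve. all: by end_near. Qed.

Lemma tangent_basis_exists (S : set 'rV[R]_4) q :
  C1_submanifold S -> S q -> exists t, tangent_basis S q t.
Proof.
move=> hS Sq; have [W [U [f [oW Wq oU ef fU]]]] := hS q Sq.
have [u Uu fu] : (f @` U) q by rewrite fU.
rewrite -fu; exists (jacobian f u).
by apply: (tangent_basis_chart oW _ oU Uu ef fU); rewrite fu.
Qed.

Lemma tangent_translate (S : set 'rV[R]_4) p (U : set 'rV[R]_2)
    (Phi : 'rV[R]_2 -> 'rV[R]_4) u h :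
  open U -> U u -> differentiable Phi u ->
  Phi @` U `<=` ltranslate (einv p) S ->
  tangent_space S (emul p (Phi u)) (demul p (Phi u) ('D_h Phi u)).
Proof.
move=> oU Uu dPhi PhiS.
exists (fun s => emul p (Phi (u + s *: h))); split.
- by rewrite scale0r addr0.
- apply: filterS (near_line h oU Uu) => s Us.
  have [|x Sx <-] := PhiS (Phi (u + s *: h)); first by exists (u + s *: h).
  by rewrite emul_einvK.
- have := is_derive_emul p (derivable_line h dPhi).
  by rewrite /= scale0r addr0.
Qed.

(** * Degree of a tangent plane *)

Lemma wedge_mul (a b : 'rV[R]_4) (E : 'M[R]_4) :
  wedge (a *m E) (b *m E) = E^T *m wedge a b *m E.
Proof. by rewrite /wedge !trmx_mul mulmxBr mulmxBl !mulmxA. Qed.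

(** The bivector with coordinates c i j, i < j, in the standard basis. *)
Definition antisym (c : 'M[R]_4) : 'M[R]_4 :=
  \matrix_(k, l) ((k < l)%N%:R * c k l - (l < k)%N%:R * c l k).

Lemma sum_wedge_row (E c : 'M[R]_4) :
  \sum_(i < 4) \sum_(j < 4 | (i < j)%N) c i j *: wedge (row i E) (row j E) =
  E^T *m antisym c *m E.
Proof.
have -> : antisym c = \sum_(i < 4) \sum_(j < 4 | (i < j)%N)
    c i j *: wedge (delta_mx 0 i) (delta_mx 0 j).
  apply/matrixP => k l; rewrite !mxE summxE.
  transitivity (\sum_(i < 4) \sum_(j < 4) (i < j)%N%:R *
    (c i j * ((i == k) && (j == l))%:R - c i j * ((i == l) && (j == k))%:R)).
    under eq_bigr do under eq_bigr do rewrite mulrBr.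
    under eq_bigr do rewrite sumrB.
    rewrite sumrB; congr (_ - _).
      rewrite (bigD1 k) //= (bigD1 l) //= !eqxx mulr1 !big1 ?addr0 //.
        by move=> i /negPf ik; rewrite big1 // => j _; rewrite ik !mulr0.
      by move=> j /negPf jl; rewrite jl andbF !mulr0.
    rewrite (bigD1 l) //= (bigD1 k) //= !eqxx mulr1 !big1 ?addr0 //.
      by move=> i /negPf ik; rewrite big1 // => j _; rewrite ik !mulr0.
    by move=> j /negPf jl; rewrite jl andbF !mulr0.
  apply: eq_bigr => i _; rewrite summxE [in RHS]big_mkcond.
  apply: eq_bigr => j _.
  case: ifP => _; last by rewrite mul0r.
  rewrite mul1r !mxE !big_ord1 !mxE !eqxx !andTb -mulrBr -!mulnb !natrM.
  rewrite ![k == _]eq_sym ![l == _]eq_sym.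
  by congr (_ * (_ - _)); rewrite mulrC.
rewrite mulmx_sumr mulmx_suml; apply: eq_bigr => i _.
rewrite mulmx_sumr mulmx_suml; apply: eq_bigr => j _.
by rewrite -scalemxAr -scalemxAl -wedge_mul !rowE.
Qed.

Lemma wedge_antisym (a b : 'rV[R]_4) :
  antisym (\matrix_(i, j) (a 0 i * b 0 j - a 0 j * b 0 i)) = wedge a b.
Proof.
apply/matrixP => k l; rewrite !mxE !big_ord1 !mxE.
by case: ltngtP => [_|_|/val_inj ->] /=; ring.
Qed.

Definition linv_mx p : 'M[R]_4 := lin1_mx (demul p 0).

Lemma row_linv_mx m p (Y : 'M[R]_(m, 4)) i :
  row i (Y *m linv_mx p) = linv (row i Y) p.
Proof. by rewrite row_mul mul_rV_lin1 linvE. Qed.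

Lemma mcformK p (v : 'rV[R]_4) : mcform p v *m linv_mx p = v.
Proof. by rewrite mul_rV_lin1 /= demul0_mcform. Qed.

Lemma linv_mxK p (v : 'rV[R]_4) : mcform p (v *m linv_mx p) = v.
Proof. by rewrite mul_rV_lin1 /= mcform_demul0. Qed.

Lemma linv_mx_unit p : linv_mx p \in unitmx.
Proof.
rewrite -row_free_unit; apply/row_freeP; exists (lin1_mx (mcform p)).
apply/row_matrixP => i.
by rewrite row_mul mul_rV_lin1 /= rowE linv_mxK row1.
Qed.

Lemma sum_wedge_linv p (Y c : 'M[R]_4) :
  \sum_(i < 4) \sum_(j < 4 | (i < j)%N)
     c i j *: wedge (linv (row i Y) p) (linv (row j Y) p) =
  (Y *m linv_mx p)^T *m antisym c *m (Y *m linv_mx p).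
Proof.
rewrite -sum_wedge_row; apply: eq_bigr => i _; apply: eq_bigr => j _.
by rewrite !row_linv_mx.
Qed.

Lemma mulmx2 (u : 'rV[R]_2) n (t : 'M[R]_(2, n)) :
  u *m t = u 0 0 *: row 0 t + u 0 1 *: row 1 t.
Proof.
rewrite mulmx_sum_row !big_ord_recl big_ord0 addr0.
by rewrite (_ : lift _ _ = 1) //; apply/val_inj.
Qed.

(** If a and b are the coordinates of the basis vectors in the left invariant
    frame of the X_i, the bivector has coordinates a_i b_j - a_j b_i.  Those with
    j = 3 have degree at least 4, so they vanish, which reads b_3 a = a_3 b; as a
    and b are independent, a_3 = b_3 = 0. *)
Lemma mcform_tangent (S : set 'rV[R]_4) q (t : 'M[R]_(2, 4)) v :
  tangent_basis S q t -> (forall e, degree_at S q e -> (e <= 3)%N) ->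
  tangent_space S q v -> mcform q v 0 3 = 0.
Proof.
move=> tb deg3; have [tfree tS] := tb; rewrite tS => /submxP[d ->].
have tE k : row k t = mcform q (row k t) *m linv_mx q by rewrite mcformK.
move: (tE 0) (tE 1); set a := mcform q (row 0 t); set b := mcform q (row 1 t).
have aE : mcform q (row 0 t) = a by []; have bE : mcform q (row 1 t) = b by [].
clearbody a b => t0 t1.
pose c : 'M[R]_4 := \matrix_(i, j) (a 0 i * b 0 j - a 0 j * b 0 i).
have dS : degree_at S q (\max_(i < 4) \max_(j < 4 | (i < j) && (c i j != 0%R))
    (deg i + deg j))%N.
  exists t, 1%:M, c; split=> //; first exact: graded_basis1.
  by rewrite sum_wedge_linv mul1mx wedge_antisym -wedge_mul t0 t1.
have c3 (i : 'I_4) : (i < 3)%N -> c i 3 = 0.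
  move=> i3; apply/eqP; apply: contraT => ci3.
  have : (4 <= deg i + deg 3%R)%N by move: i i3 {ci3} => [[|[|[|]]]].
  suff le3 : (deg i + deg 3%R <= 3)%N by move=> h; have := leq_trans h le3.
  apply: leq_trans (deg3 _ dS); apply: (bigop.bigmax_sup i) => //.
  by apply: (bigop.bigmax_sup 3%R) => //; rewrite i3.
have ab : b 0 3 *: a - a 0 3 *: b = 0.
  apply/rowP => i; rewrite !mxE.
  have [i3|] := ltnP i 3; first by rewrite -(c3 i i3) mxE; ring.
  move: i => [[|[|[|[|//]]]] i4] //= _.
  by rewrite (_ : Ordinal _ = 3) ?[b 0 3 * _]mulrC ?subrr //; apply/val_inj.
pose u : 'rV[R]_2 := \row_k (if k == 0 then b 0 3 else - a 0 3).
have u0 : u = 0.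
  have [P tP] := row_freeP tfree; rewrite -[u]mulmx1 -tP mulmxA.
  rewrite mulmx2 !mxE /= scaleNr t0 t1.
  by rewrite !scalemxAl -mulmxBl ab !mul0mx.
have b3 : b 0 3 = 0.
  by have := congr1 (fun w : 'rV[R]_2 => w 0 0) u0; rewrite !mxE.
have a3 : a 0 3 = 0.
  have := congr1 (fun w : 'rV[R]_2 => w 0 1) u0.
  by rewrite !mxE /= => /eqP; rewrite oppr_eq0 => /eqP.
by rewrite mulmx2 linearD !linearZ /= aE bE !mxE a3 b3 !mulr0 addr0.
Qed.

(** The bivector of two vectors of V_1 is a multiple of Y_0 /\ Y_1.  As t, Y and
    the coordinates c are those that the degree comes with, this bounds the degree
    because a bivector determines its coordinates. *)
Lemma degree_horizontal (S : set 'rV[R]_4) q d :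
  (forall v, tangent_space S q v -> mcform q v 0 2 = 0 /\ mcform q v 0 3 = 0) ->
  degree_at S q d -> (d <= 2)%N.
Proof.
move=> TS [t [Y [c [[tfree tS] gY tc ->]]]].
have [Yu _] := gY; have [Y22 Y33] := graded_basis_diag gY.
pose z k := mcform q (row k t) *m invmx Y.
have zE k : row k t = z k *m (Y *m linv_mx q).
  by rewrite mulmxA mulmxKV // mcformK.
have z23 k : z k 0 2 = 0 /\ z k 0 3 = 0.
  have [] : mcform q (row k t) 0 2 = 0 /\ mcform q (row k t) 0 3 = 0.
    by apply: TS; rewrite tS /=; exact: row_sub.
  rewrite -[mcform _ _](mulmxKV Yu) -/(z k).
  have [-> ->] := graded_basis_mul (z k) gY.
  by move=> /eqP + /eqP; rewrite !mulf_eq0 (negPf Y22) (negPf Y33) !orbF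
    => /eqP ? /eqP.
have cz : antisym c = wedge (z 0) (z 1).
  have Eu : Y *m linv_mx q \in unitmx by rewrite unitmx_mul Yu linv_mx_unit.
  move: tc; rewrite sum_wedge_linv !zE wedge_mul => /(can_inj (mulmxK Eu)).
  have Etu : (Y *m linv_mx q)^T \in unitmx by rewrite unitmx_tr.
  by move/(can_inj (mulKmx Etu)).
clearbody z.
apply/bigmax_leqP => i _; apply/bigmax_leqP => j /andP[ij cij].
have [j2|j2] := ltnP j 2.
  by move: i j ij j2 {cij} => [[|[|[|[|//]]]] ?] [[|[|[|[|//]]]] ?].
case/eqP: cij.
have /matrixP/(_ i j) := cz; rewrite !mxE !big_ord1 !mxE ij ltnNge (ltnW ij).
rewrite mul1r mul0r subr0 => ->.
suff zj k : z k 0 j = 0 by rewrite !zj !mulr0 subr0.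
have [z2 z3] := z23 k.
move: j j2 {ij} => [[|[|[|[|//]]]] j4] //= _.
- by rewrite (_ : Ordinal _ = 2) //; apply/val_inj.
- by rewrite (_ : Ordinal _ = 3) //; apply/val_inj.
Qed.

(** Two independent tangent vectors span the tangent plane. *)
Lemma degree_horizontal_plane (S : set 'rV[R]_4) q t (J : 'M[R]_(2, 4)) d :
  tangent_basis S q t -> row_free J ->
  (forall k, tangent_space S q (linv (row k J) q)) ->
  (forall k, J k 2 = 0 /\ J k 3 = 0) ->
  degree_at S q d -> (d <= 2)%N.
Proof.
move=> [tfree tS] Jfree SJ J23; apply: degree_horizontal => v.
have Jt : (J *m linv_mx q <= t)%MS.
  apply/row_subP => k; rewrite row_linv_mx.
  by move: (SJ k); rewrite tS.
have tJ : (t <= J *m linv_mx q)%MS.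
  rewrite -(mxrank_leqif_sup Jt).2 mxrankMfree ?row_free_unit ?linv_mx_unit //.
  by rewrite (eqP Jfree) (eqP tfree).
rewrite tS => vt; have /submxP[z ->] := submx_trans vt tJ.
rewrite mulmxA linv_mxK !mxE.
by split; rewrite big1 // => k _; have [J2 J3] := J23 k;
  rewrite ?J2 ?J3 mulr0.
Qed.

End EngelSurfaces.

Theorem theorem6p2 (R : realType)
    (g : 'rV[R]_4 -> 'rV[R]_4 -> 'rV[R]_4 -> R)
    (hg : left_invariant_metric g)
    (hgrad : exists Z : 'M[R]_4, graded_basis Z /\ orthonormal g Z)
    (Sigma : set 'rV[R]_4) (hSigma : C1_submanifold Sigma)
    (hdeg : has_degree Sigma 3)
    (p : 'rV[R]_4) (hp : Sigma p)
    (hpdeg : degree_at Sigma p 3)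
    (alpha : 'I_3 -> nat) (Y : 'M[R]_4) (U : set 'rV[R]_2)
    (Phi : 'rV[R]_2 -> 'rV[R]_4)
    (hspec : special_parametrization g (ltranslate (einv p) Sigma)
               alpha Y U Phi)
    (xi12 xi13 xi23 : R)
    (h12 : bracket (row 0 Y) (row 1 Y) = xi12 *: row 2 Y)
    (h13 : bracket (row 0 Y) (row 2 Y) = xi13 *: row 3 Y)
    (h23 : bracket (row 1 Y) (row 2 Y) = xi23 *: row 3 Y) :
  xi13 = 0.
Proof.
have [[ale asum] [gY _] [_ oU U0] [[PhiC1 Phirk _ _] PhiS Phi0]] := hspec.
move=> [_ Dblock].
have [Yu _] := gY; have [Y22 Y33] := graded_basis_diag gY.
have dPhi u : U u -> differentiable Phi u by move=> /PhiC1[].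
have TSigma q v : Sigma q -> tangent_space Sigma q v -> mcform q v 0 3 = 0.
  move=> Sq; have [t tb] := tangent_basis_exists hSigma Sq.
  by apply: (mcform_tangent tb) => e; case: hdeg => _; exact.
have TPhi u h : U u ->
    tangent_space Sigma (emul p (Phi u)) (demul p (Phi u) ('D_h Phi u)).
  by move=> Uu; apply: (tangent_translate h oU Uu (dPhi u Uu) PhiS).
have SPhi u : U u -> Sigma (emul p (Phi u)).
  move=> Uu; have [|x Sx <-] := PhiS (Phi u); first by exists u.
  by rewrite emul_einvK.
have contactPhi u h : U u -> mcform (Phi u) ('D_h Phi u) 0 3 = 0.
  move=> Uu; rewrite -(mcform_demul p).
  exact: TSigma (SPhi u Uu) (TPhi u h Uu).
set M := Dmx (Fexp_inv Y \o Phi) 0 in Dblock.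
have JM k : row k (jacobian Phi 0) = row k M^T *m Y.
  rewrite /M /Dmx trmxK /comp /Fexp_inv (jacobian_mulmxr _ (dPhi 0 U0)).
  by rewrite row_mul mulmxKV.
have DPhi k u : U u -> 'D_(delta_mx 0 k) Phi u = row k (jacobian Phi u).
  by move=> Uu; rewrite deriveEjacobian ?rowE //; exact: dPhi.
set a0 := alpha 0; set a1 := alpha 1; set a2 := alpha 2.
have [mu0 mu1 mu2] : [/\ mucol alpha 0 = 0%N, mucol alpha 1 = a0
    & mucol alpha 2 = (a0 + a1)%N].
  rewrite /mucol; split; rewrite big_mkcond !big_ord_recl big_ord0 /=.
  - by [].
  - by rewrite !addn0; congr alpha; apply/val_inj.
  - by rewrite !addn0; congr (alpha _ + alpha _)%N; apply/val_inj.
have [ml0 ml1 ml2] : [/\ mlayer 0 = 0%N, mlayer 1 = 2%N & mlayer 2 = 3%N].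
  by rewrite /mlayer; split; rewrite big_mkcond !big_ord_recl big_ord0.
have asum3 : (a0 + a1 + a2 = 2)%N.
  rewrite -asum !big_ord_recl big_ord0 /= addn0 addnA.
  by congr (alpha _ + alpha _ + alpha _)%N; apply/val_inj.
have a0le : (a0 <= 2)%N := ale 0.
have a1le : (a1 <= 1)%N := ale 1.
have a2le : (a2 <= 1)%N := ale 2.
have J23 k : jacobian Phi 0 k 2 = M 2 k * Y 2 2 /\
    jacobian Phi 0 k 3 = M 3 k * Y 3 3.
  have [] := graded_basis_mul (row k M^T) gY; rewrite -JM.
  by rewrite ![row _ _ _ _]mxE ![M^T _ _]mxE.
(* theta vanishes on the tangent plane at the unit. *)
have M3 k : M 3 k = 0.
  have := contactPhi 0 (delta_mx 0 k) U0; rewrite DPhi // Phi0 mcform0 mxE.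
  have [_ ->] := J23 k => /eqP.
  by rewrite mulf_eq0 (negPf Y33) orbF => /eqP.
(* Otherwise the diagonal block of layer V_3 puts a 1 in row 3 of M. *)
have a20 : a2 = 0%N.
  apply/eqP; rewrite -leqn0 leqNgt; apply/negP => a2gt0.
  have a2E : a2 = 1%N by apply/eqP; rewrite eqn_leq a2le.
  have a01 : (a0 + a1 = 1)%N by move: asum3; rewrite a2E addn1 => -[].
  have [||_ /(_ erefl) + _] := Dblock 2 2 3 1.
  - by rewrite ml2.
  - by rewrite mu2 -/a2 a01 a2E.
  by rewrite M3 ml2 mu2 a01 /= => /esym/eqP; rewrite oner_eq0.
(* Otherwise both tangent vectors are horizontal, and p has degree 2. *)
have a0N2 : a0 != 2%N.
  apply/negP => /eqP a02.
  have M2 k : M 2 k = 0.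
    have [||+ _ _] := Dblock 1 0 2 k; last exact.
    - by rewrite ml1.
    - by rewrite mu0 -/a0 a02 /=.
  have [t tb] := tangent_basis_exists hSigma hp.
  have : (3 <= 2)%N; last by [].
  apply: (degree_horizontal_plane (J := jacobian Phi 0) tb _ _ _ hpdeg).
  - by rewrite /row_free -mxrank_tr; apply/eqP; exact: Phirk.
  - move=> k; rewrite linvE -DPhi //.
    by rewrite -[X in tangent_space _ X](emul0 p) -Phi0; exact: TPhi.
  - by move=> k; have [-> ->] := J23 k; rewrite M2 M3 !mul0r.
have [a01 a11] : a0 = 1%N /\ a1 = 1%N.
  move: asum3 a0le a1le a0N2; rewrite a20 addn0.
  by case: (a0) (a1) => [|[|[|?]]] [|[|?]].
(* With alpha = (1, 1, 0) the columns of M are (1, 0, 0, 0) and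
   (0, lambda, 1, 0). *)
have M00 : M 0 0 = 1.
  have [||_ /(_ erefl) -> _] := Dblock 0 0 0 0; first by rewrite ml0.
    by rewrite mu0 -/a0 a01.
  by rewrite ml0 mu0.
have M10 : M 1 0 = 0.
  have [||_ /(_ erefl) -> _] := Dblock 0 0 1 0; first by rewrite ml0.
    by rewrite mu0 -/a0 a01.
  by rewrite ml0 mu0.
have M20 : M 2 0 = 0.
  have [||+ _ _] := Dblock 1 0 2 0; last exact; first by rewrite ml1.
  by rewrite mu0 -/a0 a01.
have M21 : M 2 1 = 1.
  have [||_ /(_ erefl) -> _] := Dblock 1 1 2 1; first by rewrite ml1.
    by rewrite mu1 -/a1 a01 a11.
  by rewrite ml1 mu1 a01.
have J00 : jacobian Phi 0 0 0 = Y 0 0.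
  have : row 0 (jacobian Phi 0) 0 0 = (row 0 M^T *m Y) 0 0 by rewrite JM.
  rewrite [LHS]mxE => ->; rewrite mxE (bigD1 0) //= (bigD1 1) //= big1.
    by rewrite ![row _ _ _ _]mxE ![M^T _ _]mxE M00 M10; ring.
  move=> i i01; rewrite (graded_basis_coord gY) ?mulr0 //.
  by move: i i01 => [[|[|[|[|//]]]]].
have : bracket (row 0 (jacobian Phi 0)) (row 1 (jacobian Phi 0)) 0 3 = 0.
  apply: (contact_bracket oU U0 PhiC1 Phi0) => u k Uu.
  by rewrite -DPhi //; exact: contactPhi.
rewrite bracketE /= ![row _ (jacobian _ _) _ _]mxE J00.
have [-> _] := J23 0; have [-> _] := J23 1.
rewrite M20 M21 !mul0r mul1r mulr0 mulr1 add0r subr0 => Y0022.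
have := congr1 (fun x : 'rV[R]_4 => x 0 3) h13.
rewrite /= bracketE /= !mxE Y0022 (graded_basis_coord (i := 0) (j := 2) gY) //.
rewrite mulr0 mulr1 mul0r subr0 add0r => /esym/eqP.
by rewrite mulf_eq0 (negPf Y33) orbF => /eqP.
Qed.
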